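(* Let $p>3$ be a prime, and let $(a_k)_{k\ge 0}$ be any sequence of $p$-adic integers, with dual sequence $(a_k^* )_{k\ge0}$. Then $$\sum_{k=0}^{(p-1)/2}\binom{2k}{k}\frac{a_{2k}^*}{4^k}\equiv p\left(\frac{-1}{p}\right)\sum_{k=0}^{p-1}\frac{2^k}{(2k+1)\binom{2k}{k}}\,a_k\pmod{p^2}.$$
   Context: The dual sequence of $(a_n)_{n\ge0}$ is $a_n^*:=\sum_{k=0}^n\binom{n}{k}(-1)^k a_k$. The symbol $\left(\frac{\cdot}{p}\right)$ is the Legendre symbol. Congruences modulo $p^2$ are in the ring $\mathbb{Z}_p$ of $p$-adic integers (each term $p\,2^k a_k/((2k+1)\binom{2k}{k})$ with $0\le k\le p-1$ is a $p$-adic integer). *)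

(* Defs.v *)
From HB Require Import structures.
From mathcomp Require Import all_boot all_order all_algebra.
From mathcomp Require Import boolp.

Set Implicit Arguments.
Unset Strict Implicit.
Unset Printing Implicit Defensive.

Import GRing.Theory.

(* The ring Z_p as the inverse limit of the rings Z/p^n Z: [x n] is the residue
   of [x] modulo [p ^ n], represented by a natural number [< p ^ n] (the bound
   follows from the compatibility condition).  The primality proof is a
   parameter so that the integral domain instance can depend on it. *)
Record padic_int (p : nat) (pr_p : prime p) := PadicInt {
  padic_res :> nat -> nat;
  padic_resP : forall n, padic_res n.+1 %% p ^ n = padic_res n
}.

Section PadicIntRing.
Local Open Scope nat_scope.
Variables (p : nat) (pr_p : prime p).
Local Notation Zp := (padic_int pr_p).
Implicit Types (x y z : Zp) (f g : nat -> nat).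

HB.instance Definition _ := gen_eqMixin Zp.
HB.instance Definition _ := gen_choiceMixin Zp.

Lemma padic_eqP x y : (forall n, x n = y n) -> x = y.
Proof.
case: x y => [f hf] [g hg] /= /funext efg; move: hf hg; rewrite efg => hf hg.
by congr PadicInt; apply: Prop_irrelevance.
Qed.

Lemma expp_gt0 n : 0 < p ^ n. Proof. by rewrite expn_gt0 prime_gt0. Qed.

Lemma padic_resS x n : x n.+1 = x n %[mod p ^ n].
Proof. by rewrite -[in RHS](padic_resP x) modn_mod. Qed.

Lemma padic_ltn x n : x n < p ^ n.
Proof. by rewrite -(padic_resP x) ltn_pmod ?expp_gt0. Qed.

Lemma padic_modn x n : x n %% p ^ n = x n.
Proof. by rewrite modn_small ?padic_ltn. Qed.

Fact padic_of_subproof f : (forall n, f n.+1 = f n %[mod p ^ n]) ->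
  forall n, (f n.+1 %% p ^ n.+1) %% p ^ n = f n %% p ^ n.
Proof. by move=> fP n; rewrite modn_dvdm ?dvdn_exp2l. Qed.

Definition padic_of f (fP : forall n, f n.+1 = f n %[mod p ^ n]) : Zp :=
  PadicInt pr_p (padic_of_subproof fP).

Fact padic_cst_subproof m n : m = m %[mod p ^ n]. Proof. by []. Qed.

Fact padic_add_subproof x y n :
  x n.+1 + y n.+1 = x n + y n %[mod p ^ n].
Proof. by rewrite -modnDm !padic_resS modnDm. Qed.

Fact padic_mul_subproof x y n :
  x n.+1 * y n.+1 = x n * y n %[mod p ^ n].
Proof. by rewrite -modnMm !padic_resS modnMm. Qed.

Fact padic_opp_subproof x n :
  p ^ n.+1 - x n.+1 = p ^ n - x n %[mod p ^ n].
Proof.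
apply/eqP; rewrite -(eqn_modDr (x n.+1)) subnK 1?ltnW ?padic_ltn //.
rewrite -modnDmr padic_resS modnDmr subnK 1?ltnW ?padic_ltn //.
by rewrite modnn expnS modnMl.
Qed.

Definition padic_nat m : Zp := padic_of (padic_cst_subproof m).
Definition padic_add x y : Zp := padic_of (padic_add_subproof x y).
Definition padic_mul x y : Zp := padic_of (padic_mul_subproof x y).
Definition padic_opp x : Zp := padic_of (padic_opp_subproof x).

Fact padic_addA : associative padic_add.
Proof.
by move=> x y z; apply: padic_eqP => n /=; rewrite modnDmr modnDml addnA.
Qed.

Fact padic_addC : commutative padic_add.
Proof. by move=> x y; apply: padic_eqP => n /=; rewrite addnC. Qed.

Fact padic_add0 : left_id (padic_nat 0) padic_add.
Proof. by move=> x; apply: padic_eqP => n /=; rewrite mod0n padic_modn. Qed.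

Fact padic_addN : left_inverse (padic_nat 0) padic_opp padic_add.
Proof.
move=> x; apply: padic_eqP => n /=.
by rewrite modnDml subnK 1?ltnW ?padic_ltn // modnn mod0n.
Qed.

HB.instance Definition _ := GRing.isZmodule.Build Zp
  padic_addA padic_addC padic_add0 padic_addN.

Fact padic_mulA : associative padic_mul.
Proof.
by move=> x y z; apply: padic_eqP => n /=; rewrite modnMmr modnMml mulnA.
Qed.

Fact padic_mulC : commutative padic_mul.
Proof. by move=> x y; apply: padic_eqP => n /=; rewrite mulnC. Qed.

Fact padic_mul1 : left_id (padic_nat 1) padic_mul.
Proof.
by move=> x; apply: padic_eqP => n /=; rewrite modnMml mul1n padic_modn.
Qed.

Fact padic_mulDl : left_distributive padic_mul padic_add.
Proof.
by move=> x y z; apply: padic_eqP => n /=; rewrite modnMml modnDm mulnDl.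
Qed.

Fact padic_one_neq0 : padic_nat 1 != padic_nat 0.
Proof.
apply/eqP => /(congr1 (fun x : Zp => x 1)) /=.
by rewrite mod0n modn_small ?expn1 ?prime_gt1.
Qed.

HB.instance Definition _ := GRing.Zmodule_isComNzRing.Build Zp
  padic_mulA padic_mulC padic_mul1 padic_mulDl padic_one_neq0.

Definition padic_unit : {pred Zp} := fun x => `[< exists y, (y * x = 1)%R >].

Definition padic_inv x : Zp :=
  if pselect (exists y : Zp, (y * x = 1)%R) is left ex then sval (cid ex)
  else x.

Fact padic_mulV : {in padic_unit, left_inverse 1%R padic_inv *%R}.
Proof.
move=> x /asboolP ex; rewrite /padic_inv.
by case: pselect => // ex'; case: (cid ex').
Qed.

Fact padic_unitP x y : (y * x = 1)%R -> padic_unit x.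
Proof. by move=> yx1; apply/asboolP; exists y. Qed.

Fact padic_inv_out : {in [predC padic_unit], padic_inv =1 id}.
Proof.
move=> x; rewrite inE /padic_inv => /asboolPn nx.
by case: pselect.
Qed.

HB.instance Definition _ := GRing.ComNzRing_hasMulInverse.Build Zp
  padic_mulV padic_unitP padic_inv_out.

Lemma padic_resD x m n : x (m + n) %% p ^ m = x m.
Proof.
elim: n => [|n IHn]; first by rewrite addn0 padic_modn.
rewrite addnS -[RHS]IHn -(padic_resP x (m + n)) modn_dvdm //.
by rewrite dvdn_exp2l ?leq_addr.
Qed.

Lemma padic_neq0P x : (x != 0)%R -> exists n, x n != 0.
Proof.
move=> x0; apply: contrapT => nx; case/eqP: x0.
apply: padic_eqP => n; rewrite /= mod0n.
by apply/eqP/negPn/negP => xn; apply: nx; exists n.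
Qed.

Fact padic_integral x y : (x * y = 0)%R -> (x == 0%R) || (y == 0%R).
Proof.
move=> xy0; apply/norP => -[/padic_neq0P [m xm] /padic_neq0P [n yn]].
have := congr1 (fun z : Zp => z (m + n)) xy0 => /=; rewrite mod0n => /eqP.
apply/negP; rewrite -/(dvdn _ _).
have ndx : ~~ (p ^ m %| x (m + n)) by rewrite /dvdn padic_resD.
have ndy : ~~ (p ^ n %| y (m + n)) by rewrite /dvdn addnC padic_resD.
have x_gt0 : 0 < x (m + n) by case: (x _) ndx; rewrite ?dvdn0.
have y_gt0 : 0 < y (m + n) by case: (y _) ndy; rewrite ?dvdn0.
rewrite pfactor_dvdn ?muln_gt0 ?x_gt0 // lognM //.
rewrite !pfactor_dvdn -?ltnNge // in ndx ndy.
by rewrite -ltnNge (leq_trans _ (leq_add ndx ndy)) // addSn addnS.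
Qed.

HB.instance Definition _ := GRing.ComUnitRing_isIntegral.Build Zp
  padic_integral.

End PadicIntRing.

Local Open Scope ring_scope.

Notation "x %:F" := (@FracField.tofrac _ x) : ring_scope.

Notation padic_num pr_p := {fraction (padic_int pr_p)}.

(* Congruence modulo [p ^ n] in Z_p between elements of Q_p; in particular both
   sides are required to be p-adic integers. *)
Definition padic_eqmod (p : nat) (pr_p : prime p) (n : nat)
    (u v : padic_num pr_p) : Prop :=
  exists x y : padic_int pr_p,
    [/\ u = x%:F, v = y%:F & exists z : padic_int pr_p, x - y = p%:R ^+ n * z].

Definition dual_seq (R : pzRingType) (a : nat -> R) (n : nat) : R :=
  \sum_(0 <= k < n.+1) 'C(n, k)%:R * (-1) ^+ k * a k.

Definition legendre (a : int) (p : nat) : int :=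
  if (p %| a)%Z then 0
  else if [exists x : 'I_p, ((x : nat)%:Z ^+ 2 == a %[mod p])%Z] then 1
  else -1.

(* Main.v *)
Require Import Defs.
From mathcomp Require Import all_boot all_order all_algebra.
From mathcomp Require Import ring zify.
Import GRing.Theory.
Local Open Scope ring_scope.

Set Implicit Arguments.
Unset Strict Implicit.
Unset Printing Implicit Defensive.

(** Both sides are linear in the sequence [a].  With [p = 2n + 1] and
[c_k = C(2k, k) / 4^k], the coefficient of [a_i] is [(-1)^i S_i] on the left,
where [S_i = sum_(k <= n) c_k C(2k, i)], and [(-1)^i T_i] on the right, where
[T_i = (-1)^n p (-2)^i / ((2i + 1) C(2i, i))]; here the Legendre symbol of [-1]
has been replaced by [(-1)^n] ([legendreN1]).  So it suffices that [S_i] and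
[T_i] are congruent modulo [p^2] for [0 <= i <= p - 1].

The numbers [c_k] are the Taylor coefficients of [1 / sqrt(1 - x^2)] in [x^2],
and [S_i] is the coefficient of [y^i] in the truncation [f] of this series
after [x^(2n)], expanded at [x = 1 + y].  The differential equation
[(1 - x^2) f' = x f] of the full series holds for the truncation up to the
single term [- (2n + 1) c_n x^(2n + 1) = - p c_n (1 + y)^p].  Comparing
coefficients of [y^(i + 1)] gives
  [(2i + 3) S_(i+1) + (i + 1) S_i = p c_n C(p, i + 1)]
([trunc_coef_rec]), whose right-hand side is divisible by [p^2] when
[i + 1 < p], while [T] satisfies the homogeneous recurrence exactly
([closed_coef_rec]).

The recurrence is run downwards from [i = p - 1]: each step then divides by
[i + 1 < p], a unit, whereas going upwards would divide by [2i + 3 = p] at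
[i + 1 = n] and lose a power of [p].  At the top, [S_(p-1) = c_n] and
[T_(p-1) = (-4)^n / C(2p - 1, p)].  They agree modulo [p^2] because
[c_n = (-4)^n] modulo [p^2], a weak form of Morley's congruence
([invsqrt_coef_half]), and [C(2p - 1, p) = 1] modulo [p^2], which is Babbage's
congruence ([bin_2p1_p_eqmod1]). *)

(** * Congruences between p-adic numbers *)

Lemma tofrac_nat (R : idomainType) m : (m%:R : R)%:F = m%:R.
Proof. exact: rmorph_nat. Qed.

Section Congruence.
Variables (p : nat) (pr_p : prime p) (n : nat).
Implicit Types (u v w : padic_num pr_p).

Local Notation "u ≡ v" := (@padic_eqmod p pr_p n u v) (at level 70).

(** The congruence is reflexive on p-adic integers only, so that a proof of
[u ≡ u] is also how the integrality of [u] is expressed below; together with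
compatibility with the operations this lets integrality and congruence be
propagated by the same lemmas. *)
Lemma padic_eqmod_int (x : padic_int pr_p) : x%:F ≡ x%:F.
Proof. by exists x, x; split=> //; exists 0; rewrite subrr mulr0. Qed.

Lemma padic_eqmod_trans v u w : u ≡ v -> v ≡ w -> u ≡ w.
Proof.
case=> x [y [-> -> [z xyE]]] [y' [t [/eqP]]].
rewrite tofrac_eq => /eqP <- -> [z' ytE]; exists x, t; split=> //.
by exists (z + z'); rewrite mulrDr -xyE -ytE addrA subrK.
Qed.

Lemma padic_eqmodD u v u' v' : u ≡ v -> u' ≡ v' -> u + u' ≡ v + v'.
Proof.
case=> x [y [-> -> [z xyE]]] [x' [y' [-> -> [z' xyE']]]].
exists (x + x'), (y + y'); rewrite !tofracD; split=> //.
by exists (z + z'); rewrite mulrDr -xyE -xyE'; ring.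
Qed.

Lemma padic_eqmodN u v : u ≡ v -> - u ≡ - v.
Proof.
case=> x [y [-> -> [z xyE]]]; exists (- x), (- y); rewrite !tofracN; split=> //.
by exists (- z); rewrite mulrN -xyE; ring.
Qed.

Lemma padic_eqmodM u v u' v' : u ≡ v -> u' ≡ v' -> u * u' ≡ v * v'.
Proof.
case=> x [y [-> -> [z xyE]]] [x' [y' [-> -> [z' xyE']]]].
exists (x * x'), (y * y'); rewrite !tofracM; split=> //.
exists (z * x' + y * z').
rewrite mulrDr mulrA -xyE (mulrCA _ y) -xyE'; ring.
Qed.

Lemma padic_eqmodX u v k : u ≡ v -> u ^+ k ≡ v ^+ k.
Proof.
move=> uv; elim: k => [|k IHk].
  by rewrite !expr0 -tofrac1; apply: padic_eqmod_int.
by rewrite !exprS; apply: padic_eqmodM.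
Qed.

Lemma padic_eqmod_sum (I : Type) (r : seq I) (P : pred I)
    (F G : I -> padic_num pr_p) : (forall i, P i -> F i ≡ G i) ->
  \sum_(i <- r | P i) F i ≡ \sum_(i <- r | P i) G i.
Proof.
move=> FG; elim/big_rec2: _ => [|i u v Pi uv].
  by rewrite -tofrac0; apply: padic_eqmod_int.
by apply: padic_eqmodD uv; apply: FG.
Qed.

Lemma padic_eqmod_nat m : m%:R ≡ m%:R.
Proof. by rewrite -tofrac_nat; apply: padic_eqmod_int. Qed.

Lemma padic_eqmod_sign m : (-1) ^+ m ≡ (-1) ^+ m.
Proof. by rewrite -tofrac1 -tofracN -tofracXn; apply: padic_eqmod_int. Qed.

Lemma padic_eqmod_multiple u v w : w ≡ w -> u = v + p%:R ^+ n * w -> v ≡ v ->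
  u ≡ v.
Proof.
case=> z [_ [-> _ _]] -> [y [_ [-> _ _]]].
exists (y + p%:R ^+ n * z), y; split=> //.
  by rewrite tofracD tofracM tofracXn tofrac_nat.
by exists z; ring.
Qed.

End Congruence.

Lemma padic_natE (p : nat) (pr_p : prime p) (m n : nat) :
  (m%:R : padic_int pr_p) n = (m %% p ^ n)%N.
Proof.
elim: m => [//|m IHm].
rewrite -natr1 -addn1.
change (((m%:R : padic_int pr_p) n + 1 %% p ^ n) %% p ^ n
        = (m + 1) %% p ^ n)%N.
by rewrite IHm modnDm.
Qed.

Lemma padic_num_nat_eq0 (p : nat) (pr_p : prime p) (m : nat) :
  ((m%:R : padic_num pr_p) == 0) = (m == 0%N).
Proof.
rewrite -tofrac_nat tofrac_eq0.
apply/eqP/eqP => [|->//] /(congr1 (fun x : padic_int pr_p => x m)).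
by rewrite padic_natE /= mod0n modn_small // ltn_expl // prime_gt1.
Qed.

Lemma eqn_modMr (m d a b : nat) : coprime m d ->
  (a * m == b * m %[mod d])%N = (a == b %[mod d])%N.
Proof.
move=> co_md; wlog le_ba : a b / (b <= a)%N => [IH|].
  by have [/IH->//|/ltnW/IH] := leqP b a; rewrite eq_sym => ->; rewrite eq_sym.
by rewrite !eqn_mod_dvd ?leq_mul // -mulnBl Gauss_dvdl // coprime_sym.
Qed.

(** The Bezout inverses of [m] modulo the powers of [p] are compatible, because
the inverse modulo [p ^ n] is unique, and so they define a p-adic integer. *)
Lemma padic_nat_unit (p : nat) (pr_p : prime p) (m : nat) :
  coprime m p -> exists y : padic_int pr_p, y * m%:R = 1.
Proof.
move=> co_mp; have [m0|m_gt0] := posnP m.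
  by move: co_mp; rewrite m0 /coprime gcd0n (gtn_eqF (prime_gt1 pr_p)).
pose f n := (egcdn m (p ^ n)).1.
have fm n : (f n * m = 1 %[mod p ^ n])%N.
  rewrite /f; case: (egcdnP (p ^ n) m_gt0) => km kn /= -> _.
  by rewrite (eqP (coprimeXr n co_mp)) modnMDl.
have fP n : (f n.+1 = f n %[mod p ^ n])%N.
  apply/eqP; rewrite -(eqn_modMr _ _ (coprimeXr n co_mp)) fm.
  rewrite -(modn_dvdm _ (dvdn_exp2l p (leqnSn n))) fm.
  by rewrite (modn_dvdm _ (dvdn_exp2l p (leqnSn n))).
exists (padic_of pr_p fP); apply: padic_eqP => n /=.
by rewrite padic_natE modnMmr modnMml fm.
Qed.

Lemma padic_eqmod_natV (p : nat) (pr_p : prime p) (n m : nat) :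
  coprime m p -> padic_eqmod n (m%:R^-1 : padic_num pr_p) m%:R^-1.
Proof.
move=> co_mp; have [y ym1] := padic_nat_unit pr_p co_mp.
have m_neq0 : (m%:R : padic_num pr_p) != 0.
  rewrite padic_num_nat_eq0; apply: contraTneq co_mp => ->.
  by rewrite /coprime gcd0n (gtn_eqF (prime_gt1 pr_p)).
suff -> : (m%:R^-1 : padic_num pr_p) = y%:F by apply: padic_eqmod_int.
apply: (mulIf m_neq0); rewrite mulVf //.
by rewrite -tofrac_nat -tofracM ym1 tofrac1.
Qed.

(** * Central binomial coefficients *)

Lemma central_binS k :
  (k.+1 * 'C(2 * k.+1, k.+1) = 2 * (2 * k).+1 * 'C(2 * k, k))%N.
Proof.
have -> : (2 * k.+1 = (2 * k).+2)%N by lia.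
have h1 := mul_bin_diag (2 * k).+2 k.
have h2 := mul_bin_down (2 * k).+1 k.
rewrite /= in h1 h2.
have e : ((2 * k).+1 - k = k.+1)%N by lia.
rewrite e in h2; nia.
Qed.

Lemma central_bin_odd_prod n :
  ('C(2 * n, n) * n`! = 2 ^ n * \prod_(j < n) (2 * j).+1)%N.
Proof.
elim: n => [|n IHn]; first by rewrite big_ord0.
rewrite big_ord_recr /= expnS factS mulnA (mulnC _ n.+1) central_binS.
by rewrite -[LHS]mulnA IHn; ring.
Qed.

(** The coefficient [E] does not depend on [x], so that expansions at different
points can be compared. *)
Lemma prod_shift_expand (R : comPzRingType) n : exists E : R, forall x : R,
  exists w, \prod_(i < n) (x + i.+1%:R) = n`!%:R + x * E + x ^+ 2 * w.
Proof.
elim: n => [|n [E IHn]].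
  by exists 0 => x; exists 0; rewrite big_ord0 !mulr0 !addr0.
exists (n`!%:R + n.+1%:R * E) => x; have [w wE] := IHn x.
exists (E + n.+1%:R * w + x * w).
rewrite big_ord_recr /= wE factS natrM; ring.
Qed.

(** With [h = p / 2] and [P(x) = (x + 1) ... (x + n)], pairing factors gives
[C(2n, n) n! = (-1)^n P(-p) = (-4)^n P(-p/2)].  To first order [P] is affine
with constant term [n!], hence [P(-p/2)^2 = n! P(-p)] modulo [h^2].  Eliminating
[P] yields [C(2n, n)^2 = (-16)^n C(2n, n)] modulo [p^2], up to the unit [n!^2]:
no harmonic number has to be evaluated. *)
Lemma central_bin_sq (R : comPzRingType) n (h : R) : (2 * n).+1%:R = 2 * h ->
  exists w, n`!%:R ^+ 2 * ('C(2 * n, n)%:R ^+ 2 - (-16) ^+ n * 'C(2 * n, n)%:R)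
    = h ^+ 2 * w.
Proof.
move=> hE; have [E PE] := prod_shift_expand R n.
have constX (c : R) : c ^+ n = \prod_(i < n) c by rewrite prodr_const card_ord.
pose P (x : R) := \prod_(i < n) (x + i.+1%:R).
have P2h : 'C(2 * n, n)%:R * n`!%:R = (-1) ^+ n * P (- (2 * h)).
  rewrite -natrM bin_ffact ffact_prod natr_prod constX -big_split /=.
  apply: eq_bigr => i _.
  rewrite -hE natrB; last by have := ltn_ord i; lia.
  by rewrite -!natr1; ring.
have Ph : 'C(2 * n, n)%:R * n`!%:R = (-4) ^+ n * P (- h).
  rewrite -natrM central_bin_odd_prod natrM natrX natr_prod.
  rewrite (reindex_inj rev_ord_inj) /= !constX -!big_split /=.
  apply: eq_bigr => i _.
  (* Twice a factor of [P(-h)] is minus an odd number below [2n + 1]. *)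
  have -> : (-4) * (- h + i.+1%:R) = 2 * (2 * h - 2 * i.+1%:R) by ring.
  rewrite -hE -natrM -natrB; last by have := ltn_ord i; lia.
  by congr (_ * _%:R); have := ltn_ord i; lia.
have [w wE] := PE (- h); have [v vE] := PE (- (2 * h)).
rewrite -/(P (- h)) in wE; rewrite -/(P (- (2 * h))) in vE.
pose N : R := n`!%:R.
(* This is [16^n] times the quotient of [P(-h)^2 - n! P(-2h)] by [h^2]. *)
exists (16 ^+ n * (E ^+ 2 - 2 * h * E * w + h ^+ 2 * w ^+ 2
  + 2 * N * w - 4 * N * v)).
have -> : (-16) ^+ n = 16 ^+ n * (-1) ^+ n :> R.
  by rewrite -exprMn; congr (_ ^+ _); ring.
have s2 : (-1) ^+ n * (-1) ^+ n = 1 :> R by rewrite -expr2 sqrr_sign.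
have e16 : (-4) ^+ n * (-4) ^+ n = 16 ^+ n :> R.
  by rewrite -exprMn; congr (_ ^+ _); ring.
transitivity (('C(2 * n, n)%:R * N) ^+ 2
   - 16 ^+ n * (-1) ^+ n * N * ('C(2 * n, n)%:R * N)); first by rewrite /N; ring.
rewrite {1}Ph {1}P2h.
transitivity (((-4) ^+ n * (-4) ^+ n) * P (- h) ^+ 2
   - 16 ^+ n * ((-1) ^+ n * (-1) ^+ n) * N * P (- (2 * h))); first by ring.
rewrite s2 e16 wE vE -/N; ring.
Qed.

(** Vandermonde's identity writes [C(2p, p)] as the sum of the [C(p, k)^2], in
which only the two extreme terms are not divisible by [p^2]. *)
Lemma bin_2p_p p : prime p -> exists w, ('C(2 * p, p) = 2 + p ^ 2 * w)%N.
Proof.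
move=> pr_p; have p_gt0 := prime_gt0 pr_p.
case: p pr_p p_gt0 => // q pr_p _; set p := q.+1 in pr_p *.
rewrite mul2n -addnn -binomial.Vandermonde big_ord_recr big_ord_recl /=.
rewrite subnn subn0 !bin0 !binn !muln1.
suff /dvdnP[w ->] :
    (p ^ 2 %| \sum_(i < q) 'C(p, bump 0 i) * 'C(p, p - bump 0 i))%N.
  by exists w; ring.
apply: dvdn_sum => i _; rewrite bin_sub /bump ?add1n ?ltnS; last first.
  by rewrite /p; have := ltn_ord i; lia.
by rewrite expnS expn1 dvdn_mul // prime_dvd_bin //= ltnS.
Qed.

Lemma double_bin_2p1_p p : prime p -> exists w,
  (2 * 'C(2 * p - 1, p) = 2 + p ^ 2 * w)%N.
Proof.
move=> pr_p; have [w wE] := bin_2p_p pr_p; exists w.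
have := mul_bin_down (2 * p) p; rewrite wE.
have -> : (2 * p - p = p)%N by lia.
have -> : ((2 * p).-1 = 2 * p - 1)%N by lia.
rewrite -mulnA mulnCA => /eqP; rewrite eqn_pmul2l ?prime_gt0 //.
by move/eqP.
Qed.

(** * The truncated series and its recurrence *)

(** This is the increment of the recurrence [trunc_coef_rec] from [n] to [n + 1],
divided by the common factor [c_(n + 1)], with [m = 2n + 1]. *)
Lemma bin_trunc_step m i :
  (m.+1 * 'C(m, i.+1) + ((2 * i + 3) * 'C(m.+1, i.+1) + i.+1 * 'C(m.+1, i))
   = m.+2 * 'C(m.+2, i.+1))%N.
Proof.
have e1 := mul_bin_down m.+1 i.+1; rewrite /= in e1.
have e2 := mul_bin_left m.+1 i.
rewrite e1 (binS m.+1); move: e2.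
have [lt|ge] := leqP i.+1 m.+1.
  have [k ek] : exists k, m.+1 = (k + i.+1)%N by exists (m - i)%N; lia.
  have -> : (m.+1 - i = k.+1)%N by lia.
  have -> : (m.+1 - i.+1 = k)%N by lia.
  have -> : (m.+2 = k + i.+2)%N by lia.
  by move: 'C(_, _) 'C(_, _) => u v; nia.
rewrite (@bin_small _ i.+1) // => _.
have [lt2|ge2] := ltnP m.+1 i; first by rewrite bin_small //; lia.
have -> : i = m.+1 by lia.
by rewrite binn; lia.
Qed.

Section TruncatedSum.
Variable F : fieldType.

(** The coefficient of [x ^ (2 * k)] in the series of [1 / sqrt(1 - x ^ 2)]. *)
Definition invsqrt_coef k : F := 'C(2 * k, k)%:R / 4 ^+ k.

(** The coefficient of [y ^ i] in the sum of the [c_k (1 + y) ^ (2 * k)] over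
[k <= n], where [c_k] is [invsqrt_coef k]. *)
Definition trunc_coef n i : F :=
  \sum_(0 <= k < n.+1) invsqrt_coef k * 'C(2 * k, i)%:R.

Lemma invsqrt_coefS k : (2 : F) != 0 ->
  (2 * k).+2%:R * invsqrt_coef k.+1 = (2 * k).+1%:R * invsqrt_coef k.
Proof.
move=> F2; have F4 : (4 : F) != 0.
  by rewrite (_ : 4 = 2 * 2) ?mulf_neq0 //; ring.
rewrite /invsqrt_coef exprS.
have := congr1 (fun m => m%:R : F) (central_binS k).
rewrite /= !natrM -[k.+1%:R in LHS]natr1 => e.
have -> : (2 * k).+2%:R = 2 * (k%:R + 1) :> F by rewrite -!natr1 natrM; ring.
transitivity (2 * ((k%:R + 1) * 'C(2 * k.+1, k.+1)%:R) / (4 * 4 ^+ k) : F).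
  by ring.
rewrite e; field.
by rewrite expf_neq0 //= F4.
Qed.

(** The differential equation [y (2 + y) f' + (1 + y) f = (2n + 1) c_n
(1 + y)^(2n + 1)] of the truncated series, read off at [y^(i + 1)]. *)
Lemma trunc_coef_rec n i : (2 : F) != 0 ->
  (2 * i + 3)%:R * trunc_coef n i.+1 + i.+1%:R * trunc_coef n i
  = (2 * n + 1)%:R * invsqrt_coef n * 'C(2 * n + 1, i.+1)%:R.
Proof.
move=> F2; elim: n => [|n IHn].
  rewrite /trunc_coef !big_nat1 /= /invsqrt_coef /= expr0 divr1 !mul1r.
  by case: i => [|i]; rewrite ?mulr0 ?mulr1 /= ?bin0n /= ?mulr0 ?addr0 ?add0r.
rewrite /trunc_coef !(big_nat_recr n.+1) //= -!/(trunc_coef n _).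
rewrite !mulrDr addrACA IHn !addn1 -invsqrt_coefS //.
have -> : (2 * n.+1 = (2 * n).+2)%N by lia.
have := congr1 (fun m => m%:R : F) (bin_trunc_step (2 * n).+1 i).
move: 'C((2 * n).+1, i.+1) 'C((2 * n).+2, i.+1) 'C((2 * n).+2, i)
  'C((2 * n).+3, i.+1) => u v w x.
rewrite !(natrD, natrM) => e.
transitivity (invsqrt_coef n.+1 * ((2 * n).+2%:R * u%:R +
    ((2%:R * i%:R + 3%:R) * v%:R + i.+1%:R * w%:R))).
  by ring.
by rewrite e; ring.
Qed.

Lemma trunc_coef_last n : trunc_coef n (2 * n) = invsqrt_coef n.
Proof.
rewrite /trunc_coef big_nat_recr //= binn mulr1 big_nat big1 ?add0r // => k ltkn.
by rewrite (@bin_small (2 * k)) ?mulr0 //; lia.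
Qed.

(** The solution, up to a constant factor, of the recurrence [trunc_coef_rec]
without its right-hand side. *)
Definition closed_coef i : F := (-2) ^+ i / ((2 * i + 1)%:R * 'C(2 * i, i)%:R).

Lemma closed_coef_rec i : (forall m, (m.+1%:R : F) != 0) ->
  (2 * i + 3)%:R * closed_coef i.+1 + i.+1%:R * closed_coef i = 0.
Proof.
move=> char0; rewrite /closed_coef exprS.
have C_neq0 k : ('C(2 * k, k)%:R : F) != 0.
  have := bin_gt0 (2 * k) k; case: 'C(2 * k, k) => [|m] //; lia.
have e : (i.+1%:R * 'C(2 * i.+1, i.+1)%:R = 2 * (2 * i + 1)%:R * 'C(2 * i, i)%:R :> F).
  by rewrite -!natrM central_binS addn1.
have c1 : 'C(2 * i.+1, i.+1)%:R = 2 * (2 * i + 1)%:R * 'C(2 * i, i)%:R / i.+1%:R :> F.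
  by rewrite -e mulrAC divff ?mul1r.
rewrite c1 (_ : (2 * i.+1 + 1 = 2 * i + 3)%N); last by lia.
have ni1 : ((2 * i + 1)%:R : F) != 0 by rewrite addn1.
have ni3 : ((2 * i + 3)%:R : F) != 0 by rewrite addn3.
move: ni1 ni3 (C_neq0 i) (char0 i) (char0 1%N).
move: (2 * i + 1)%:R (2 * i + 3)%:R 'C(2 * i, i)%:R i.+1%:R => a b c d na nb nc nd n2.
by field; rewrite na nb nc nd n2.
Qed.

Lemma closed_coef_last n : (forall m, (m.+1%:R : F) != 0) ->
  (2 * n + 1)%:R * closed_coef (2 * n) = 4 ^+ n / 'C(4 * n + 1, 2 * n + 1)%:R.
Proof.
move=> char0; have := mul_bin_diag (4 * n + 1) (2 * n).
rewrite !addn1 /= => /(congr1 (fun m => m%:R : F)); rewrite !natrM.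
rewrite /closed_coef !addn1 (_ : 2 * (2 * n) = 4 * n)%N; last by lia.
move=> ->; rewrite exprM sqrrN invfM mulrCA mulVKf //.
by congr (_ ^+ _ / _); ring.
Qed.

End TruncatedSum.

(** * The Legendre symbol of minus one *)

(** If [x^2 = -1] in ['F_p] then [x = x^p = (-1)^n x], which forces [n] to be
even.  Conversely Wilson's theorem reads [(-1)^n (n!)^2 = -1], so that [n!] is a
square root of [-1] when [n] is even. *)
Lemma legendreN1 n : prime (2 * n + 1) -> legendre (-1) (2 * n + 1) = (-1) ^+ n.
Proof.
move=> pr_p; set p := (2 * n + 1)%N in pr_p *.
have Fp0 m : ((m%:R : 'F_p) == 0) = (p %| m)%N.
  by rewrite (dvdn_pcharf (pchar_Fp pr_p)).
have n_gt0 : (0 < n)%N by case: n @p pr_p {Fp0}.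
rewrite /legendre dvdzE /= dvdn1 gtn_eqF; last by rewrite /p; lia.
have sqN1 (x : nat) : (x%:Z ^+ 2 == -1 %[mod p])%Z = ((x%:R : 'F_p) ^+ 2 == -1).
  rewrite eqz_mod_dvd -subr_eq0 !opprK -natrX natr1 Fp0 dvdzE /=.
  by congr (_ %| _)%N; lia.
case: ifP => [/existsP[x]|nx].
  rewrite sqN1 => /eqP x2.
  have /eqP : ((x : nat)%:R : 'F_p) ^+ p = x%:R.
    by rewrite -(pFrobenius_autE (pchar_Fp pr_p)) pFrobenius_aut_nat.
  rewrite /p exprD exprM x2 expr1 -[_ ^+ n]signr_odd -[(-1) ^+ n in RHS]signr_odd.
  case: (odd n) => //=.
  rewrite !expr1 mulN1r eq_sym -addr_eq0 -mulr2n -[_ *+ 2]mulr_natr mulf_eq0.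
  have -> : (2%:R == 0 :> 'F_p) = false by rewrite Fp0 gtnNdvd // /p; lia.
  rewrite orbF.
  move/eqP=> x0; move/eqP: x2; rewrite x0 expr0n /= eq_sym oppr_eq0 oner_eq0 //.
rewrite -signr_odd; case: (boolP (odd n)) => // n_even; case/existsP: nx.
pose x : nat := (n`! %% p)%N.
have ltxp : (x < p)%N by rewrite ltn_pmod ?prime_gt0.
exists (Ordinal ltxp); rewrite sqN1 /=.
rewrite /x Fp_nat_mod //.
have fallE : ((2 * n) ^_ n)%:R = n`!%:R :> 'F_p.
  rewrite ffact_prod fact_prod big_add1 big_mkord !natr_prod.
  transitivity (\prod_(i < n) (- i.+1%:R : 'F_p)).
    apply: eq_bigr => i _; have lt_in := ltn_ord i.
    apply/eqP; rewrite -addr_eq0 -natrD Fp0 (_ : _ + _ = p)%N //.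
    by rewrite /p; lia.
  by rewrite prodrN card_ord -signr_odd (negPf n_even) mul1r.
have := pr_p; rewrite Wilson; last by rewrite /p; lia.
rewrite -Fp0 -natr1 (_ : p.-1 = 2 * n)%N; last by rewrite /p; lia.
rewrite -(ffact_fact (_ : n <= 2 * n)%N); last by lia.
rewrite natrM fallE (_ : 2 * n - n = n)%N; last by lia.
by rewrite -addr_eq0 expr2.
Qed.

(** * The coefficientwise congruence *)

Lemma cancel_sq_eq (F : fieldType) (N C q y p w : F) : N != 0 -> C != 0 ->
  N ^+ 2 * (C ^+ 2 - q * C) = (y * p) ^+ 2 * w ->
  C = q + p ^+ 2 * (N^-1 ^+ 2 * C^-1 * (y ^+ 2 * w)).
Proof.
move=> N0 C0 e; apply: (mulfI (mulf_neq0 (expf_neq0 2 N0) C0)).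
apply/eqP; rewrite -subr_eq0; apply/eqP.
transitivity (N ^+ 2 * (C ^+ 2 - q * C) - (y * p) ^+ 2 * w).
  by field; rewrite N0 C0.
by rewrite e subrr.
Qed.

Section Supercongruence.
Variables (p : nat) (pr_p : prime p) (n : nat).
Hypotheses (pE : p = (2 * n + 1)%N) (p_gt2 : (2 < p)%N).
Local Notation K := (padic_num pr_p).
Local Notation "u ≡ v" := (@padic_eqmod p pr_p 2 u v) (at level 70).

Lemma natS_neq0 m : (m.+1%:R : K) != 0.
Proof. by rewrite padic_num_nat_eq0. Qed.

Lemma coprime_small m : (0 < m < p)%N -> coprime m p.
Proof.
by case/andP=> m_gt0 lt_mp; rewrite coprime_sym prime_coprime // gtnNdvd.
Qed.

Lemma coprime_fact m : (m < p)%N -> coprime m`! p.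
Proof.
elim: m => [|m IHm] lt_mp; first by rewrite coprime1n.
by rewrite factS coprimeMl coprime_small ?lt_mp //= IHm // ltnW.
Qed.

Lemma invsqrt_coef_int k : invsqrt_coef K k ≡ invsqrt_coef K k.
Proof.
apply: padic_eqmodM; first exact: padic_eqmod_nat.
rewrite -[_ ^+ k](natrX _ 4 k); apply: padic_eqmod_natV.
by rewrite (coprimeXl _ (m := 2 ^ 2)) // coprimeXl // coprime_small.
Qed.

(** The quadratic relation [central_bin_sq] can be divided by [C(2n, n)] and by
[n!^2], which are units because they divide [(2n)!] and [2n < p]. *)
Lemma central_bin_half_eqmod : ('C(2 * n, n)%:R : K) ≡ (-16) ^+ n.
Proof.
have [y y2] := padic_nat_unit pr_p (@coprime_small 2 p_gt2).
have hE : (2 * n).+1%:R = 2 * (y * p%:R) :> padic_int pr_p.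
  by rewrite mulrA (mulrC 2) y2 mul1r -addn1 -pE.
have [w /(congr1 (@FracField.tofrac _))] := central_bin_sq hE.
rewrite !(tofracB, tofracM, tofracXn, tofracN, tofrac_nat) => wE.
have coF : coprime (2 * n)`! p by apply: coprime_fact; rewrite pE; lia.
move: coF; rewrite -(bin_fact (_ : n <= 2 * n)%N); last by lia.
rewrite !coprimeMl => /and3P[coC coN _].
have N0 : (n`!%:R : K) != 0 by rewrite padic_num_nat_eq0 -lt0n fact_gt0.
have C0 : ('C(2 * n, n)%:R : K) != 0.
  by rewrite padic_num_nat_eq0 -lt0n bin_gt0; lia.
have int16 : ((-16) ^+ n : K) ≡ (-16) ^+ n.
  rewrite -mulN1r exprMn; apply: padic_eqmodM; first exact: padic_eqmod_sign.
  exact/padic_eqmodX/padic_eqmod_nat.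
apply: (@padic_eqmod_multiple _ _ _ _ _
  (n`!%:R^-1 ^+ 2 * 'C(2 * n, n)%:R^-1 * (y ^+ 2 * w)%:F)) => //.
  apply: padic_eqmodM; last exact: padic_eqmod_int.
  apply: padic_eqmodM; last exact: padic_eqmod_natV.
  exact/padic_eqmodX/padic_eqmod_natV.
rewrite tofracM tofracXn.
exact: cancel_sq_eq N0 C0 wE.
Qed.

Lemma invsqrt_coef_half : invsqrt_coef K n ≡ (-4) ^+ n.
Proof.
have n40 : (4 : K) != 0 by apply: (natS_neq0 3).
have -> : (-4) ^+ n = (-16) ^+ n * 4 ^- n :> K.
  rewrite -exprVn -exprMn; congr (_ ^+ _); field; exact: n40.
apply: padic_eqmodM central_bin_half_eqmod _; rewrite -[_ ^+ n](natrX _ 4 n).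
apply: padic_eqmod_natV.
by rewrite (coprimeXl _ (m := 2 ^ 2)) // coprimeXl // coprime_small.
Qed.

Lemma coprime_bin_2p1_p : coprime 'C(2 * p - 1, p) p.
Proof.
have [w wE] := double_bin_2p1_p pr_p.
have : coprime (2 * 'C(2 * p - 1, p)) p.
  rewrite wE expnS -mulnA addnC mulnC /coprime gcdnC gcdnMDl gcdnC.
  exact: coprime_small.
by rewrite coprimeMl => /andP[].
Qed.

Lemma bin_2p1_p_eqmod1 : ('C(2 * p - 1, p)%:R : K) ≡ 1.
Proof.
have [w /(congr1 (fun m => m%:R : K))] := double_bin_2p1_p pr_p.
rewrite natrM natrD (natrM _ (p ^ 2)) natrX => e.
have n20 : (2 : K) != 0 by apply: (natS_neq0 1).
rewrite -[X in X ≡ _](mulKf n20) e -[X in _ ≡ X](mulVf n20).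
apply: padic_eqmodM; first exact: padic_eqmod_natV (@coprime_small 2 p_gt2).
apply: (@padic_eqmod_multiple _ _ _ _ _ w%:R) => //; exact: padic_eqmod_nat.
Qed.

(** Descending induction on [i], the variable [j] counting the steps from the
top index [p - 1].  The error term [p c_n C(p, i + 1)] vanishes modulo [p^2] and
the step divides by [i + 1 < p], a unit. *)
Lemma trunc_coef_closed j i : (i + j = 2 * n)%N ->
  trunc_coef K n i ≡ (-1) ^+ n * p%:R * closed_coef K i.
Proof.
have n20 : (2 : K) != 0 by apply: (natS_neq0 1).
elim: j i => [|j IHj] i ijE.
  move: ijE; rewrite addn0 => ->; rewrite trunc_coef_last.
  apply: (padic_eqmod_trans invsqrt_coef_half).
  have BE : (-1) ^+ n * p%:R * closed_coef K (2 * n)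
      = (-4) ^+ n * 'C(2 * p - 1, p)%:R^-1.
    rewrite -mulrA.
    rewrite (_ : 'C(2 * p - 1, p) = 'C(4 * n + 1, 2 * n + 1)); last first.
      by rewrite pE; congr 'C(_, _); lia.
    have -> : p%:R = (2 * n + 1)%:R :> K by rewrite -pE.
    rewrite closed_coef_last; last exact: natS_neq0.
    by rewrite mulrA -exprMn mulN1r.
  rewrite BE -[X in X ≡ _]mulr1; apply: padic_eqmodM.
    rewrite -mulN1r exprMn; apply: padic_eqmodM; first exact: padic_eqmod_sign.
    exact/padic_eqmodX/padic_eqmod_nat.
  have B0 : ('C(2 * p - 1, p)%:R : K) != 0.
    by rewrite padic_num_nat_eq0 -lt0n bin_gt0; lia.
  rewrite -[X in X ≡ _](mulVf B0) -[X in _ ≡ X]mulr1.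
  apply: padic_eqmodM bin_2p1_p_eqmod1; apply: padic_eqmod_natV.
  exact: coprime_bin_2p1_p.
have {}IHj : trunc_coef K n i.+1 ≡ (-1) ^+ n * p%:R * closed_coef K i.+1.
  by apply: IHj; lia.
have i0 := natS_neq0 i.
have -> : trunc_coef K n i = i.+1%:R^-1 *
   ((2 * n + 1)%:R * invsqrt_coef K n * 'C(2 * n + 1, i.+1)%:R
     - (2 * i + 3)%:R * trunc_coef K n i.+1).
  by rewrite -trunc_coef_rec // addrAC subrr add0r mulKf.
have -> : (-1) ^+ n * p%:R * closed_coef K i
    = i.+1%:R^-1 *
      (0 - (2 * i + 3)%:R * ((-1) ^+ n * p%:R * closed_coef K i.+1)).
  apply: (mulfI i0); rewrite mulVKf // add0r.
  have := closed_coef_rec i natS_neq0 => /eqP.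
  rewrite addrC addr_eq0 => /eqP e.
  by rewrite mulrCA e; ring.
apply: padic_eqmodM; first by apply/padic_eqmod_natV/coprime_small; lia.
(* [p] divides [C(p, i + 1)], hence [p^2] divides the error term. *)
have [c cE] : exists c, ('C(2 * n + 1, i.+1) = c * p)%N.
  by apply/dvdnP; rewrite -pE prime_dvd_bin //; lia.
apply: padic_eqmodD.
  apply: (@padic_eqmod_multiple _ _ _ _ _ (invsqrt_coef K n * c%:R)).
  - by apply: padic_eqmodM; [apply: invsqrt_coef_int | apply: padic_eqmod_nat].
  - by rewrite cE -pE natrM; ring.
  - exact: (padic_eqmod_nat _ _ 0).
by apply/padic_eqmodN/(padic_eqmodM _ IHj)/padic_eqmod_nat.
Qed.

End Supercongruence.

Theorem theorem1p4 (p : nat) (pr_p : prime p) (p_gt3 : (3 < p)%N)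
    (a : nat -> padic_int pr_p) :
  padic_eqmod 2
    (\sum_(0 <= k < ((p - 1) %/ 2).+1)
       'C(2 * k, k)%:R * (dual_seq a (2 * k))%:F / 4%:R ^+ k)
    (p%:R * (legendre (-1) p)%:~R *
     \sum_(0 <= k < p)
       2%:R ^+ k / ((2 * k + 1)%:R * 'C(2 * k, k)%:R) * (a k)%:F).
Proof.
pose n := ((p - 1) %/ 2)%N; rewrite -/n.
have p_odd : odd p by case: (even_prime pr_p) p_gt3 => [->|].
have pE : p = (2 * n + 1)%N by rewrite /n; lia.
have -> : legendre (-1) p = (-1) ^+ n.
  by rewrite pE legendreN1 -?pE.
have -> : \sum_(0 <= k < n.+1)
    'C(2 * k, k)%:R * (dual_seq a (2 * k))%:F / 4%:R ^+ k
    = \sum_(0 <= i < p) (-1) ^+ i * trunc_coef (padic_num pr_p) n i * (a i)%:F.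
  (* Each dual value involves [a_i] for [i <= 2k < p] only, so the inner sums
     can all be extended to [i < p] before they are exchanged. *)
  transitivity (\sum_(0 <= k < n.+1) \sum_(0 <= i < p)
     (-1) ^+ i * (invsqrt_coef (padic_num pr_p) k * 'C(2 * k, i)%:R)
       * (a i)%:F).
    apply: eq_big_nat => k /andP[_ lekn].
    rewrite mulrAC -/(invsqrt_coef _ k) /dual_seq.
    rewrite [RHS](@big_cat_nat _ _ _ (2 * k).+1) //=; last by lia.
    rewrite [X in _ = _ + X]big_nat [X in _ = _ + X]big1 ?addr0; last first.
      by move=> i /andP[lt_ki _]; rewrite bin_small // mulr0 mulr0 mul0r.
    rewrite (big_morph _ (tofracD (R:=_)) (tofrac0 _)) mulr_sumr.
    apply: eq_bigr => i _.
    rewrite !tofracM tofrac_nat tofracXn tofracN tofrac1; ring.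
  rewrite exchange_big_nat; apply: eq_bigr => i _.
  by rewrite /trunc_coef mulr_sumr mulr_suml.
rewrite mulr_sumr rmorph_sign big_nat [X in padic_eqmod 2 _ X]big_nat.
apply: padic_eqmod_sum => i /andP[_ lt_ip].
have -> : p%:R * (-1) ^+ n *
    (2%:R ^+ i / ((2 * i + 1)%:R * 'C(2 * i, i)%:R) * (a i)%:F)
    = (-1) ^+ i * ((-1) ^+ n * p%:R * closed_coef (padic_num pr_p) i) * (a i)%:F.
  rewrite /closed_coef (_ : (-2) ^+ i = (-1) ^+ i * 2 ^+ i); last first.
    by rewrite -exprMn mulN1r.
  transitivity (((-1) ^+ i * (-1) ^+ i) * (p%:R * (-1) ^+ n *
    (2%:R ^+ i / ((2 * i + 1)%:R * 'C(2 * i, i)%:R) * (a i)%:F))).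
    by rewrite -expr2 sqrr_sign mul1r.
  by ring.
apply: padic_eqmodM (padic_eqmod_int _ _).
apply: padic_eqmodM; first exact: padic_eqmod_sign.
have p_gt2 : (2 < p)%N by lia.
by apply: (@trunc_coef_closed _ pr_p _ pE p_gt2 (2 * n - i)); lia.
Qed.
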